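(* Let $v$ be a positive $2T$-periodic mountain-pass solution (as defined in the context) of $v^{(4)}+K_2v''+K_0v=v^{\frac{n+4}{n-4}}$ on $\mathbb{R}$, and let $u(x)=u(|x|)$ be the function on $\mathbb{R}^n\setminus\{0\}$ determined by $v(t)=e^{\frac{n-4}{2}t}u(e^t)$, i.e. $u(x)=|x|^{-\frac{n-4}{2}}v(\ln|x|)$. Then the following pointwise inequality holds: $$-\Delta u\ \ge\ \sqrt{\frac{n(n-4)}{n^2-4}}\;u^{\frac{n}{n-4}}+\frac{2}{n-4}\,\frac{|\nabla u|^2}{u}\qquad\text{in }\mathbb{R}^n\setminus\{0\}.$$ As a consequence, the scalar curvature $$R_g=-\frac{4(n-1)}{n-2}\,u^{-\frac{n+2}{n-4}}\,\Delta\big(u^{\frac{n-2}{n-4}}\big)$$ of the conformal metric $g=u^{\frac{4}{n-4}}g_0$ on $\mathbb{R}^n\setminus\{0\}$, where $g_0$ is the Euclidean metric, is positive.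
   Context: Throughout $n\ge5$, $K_2=-\frac{n^2-4n+8}{2}$, $K_0=\frac{n^2(n-4)^2}{16}$, $L=\big(\frac{n}{n-4}\big)^{\frac{n-4}{8}}K_0^{\frac{n-4}{8}}$, and $F(s)=\frac{K_0}{2}s^2-\frac{n-4}{2n}s^{\frac{2n}{n-4}}$ for $s\ge0$. For $-\infty<t_1<t_2<\infty$ let $H=\{v\in H^2(t_1,t_2): v'\in H^1_0(t_1,t_2)\}$ with scalar product $(u,v)_H=\int_{t_1}^{t_2}(u''v''+u'v'+uv)\,dt$, and $$J(v)=\int_{t_1}^{t_2}\Big[\tfrac12 v''^2-\tfrac{K_2}{2}v'^2+F(v)\Big]dt .$$ A critical point of $J$ with $0\le v\le L$ is a $v\in H$ with $\int_{t_1}^{t_2}[v''\phi''-K_2v'\phi'+F'(v)\phi]\,dt=0$ for all $\phi\in H$. Let $\Gamma$ be the set of $\gamma\in C^0([0,1],H)$ with $0\le\gamma_\tau\le L$ in $[t_1,t_2]$ for all $\tau\in[0,1]$, $\gamma_0\equiv0$, $\gamma_1\equiv L$. Mountain-pass solution: let $T=t_2-t_1$ be suitably large (so large that mountain-pass critical points are nonconstant), and let $v_0\in H$ be a critical point of $J$ with $0\le v_0\le L$ in $[t_1,t_2]$ and $J(v_0)=\inf_{\gamma\in\Gamma}\sup_{\tau\in[0,1]}J(\gamma_\tau)>0$. Extend $v_0$ to $[t_2,2t_2-t_1]$ by $v(t)=v_0(2t_2-t)$ and then $2T$-periodically to $\mathbb{R}$. A positive $2T$-periodic mountain-pass solution is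 a positive function $v\in C^4(\mathbb{R})$ obtained this way and solving $v^{(4)}+K_2v''+K_0v=v^{\frac{n+4}{n-4}}$ on $\mathbb{R}$. *)

(* Defs.v *)
From HB Require Import structures.
From mathcomp Require Import all_boot all_order all_algebra.
From mathcomp Require Import all_classical all_reals all_analysis.
Import Order.TTheory GRing.Theory Num.Theory.
Import numFieldNormedType.Exports.

Set Implicit Arguments.
Unset Strict Implicit.
Unset Printing Implicit Defensive.

Local Open Scope classical_set_scope.
Local Open Scope ring_scope.

Section Constants.
Variables (R : realType) (n : nat).

Definition K2 : R := - ((n%:R ^+ 2 - 4 * n%:R + 8) / 2).

Definition K0 : R := n%:R ^+ 2 * (n%:R - 4) ^+ 2 / 16.

Definition Lbound : R :=
  (n%:R / (n%:R - 4)) `^ ((n%:R - 4) / 8) * K0 `^ ((n%:R - 4) / 8).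

(* Only meaningful for 0 <= s: [powR] takes the value 1 at negative reals. *)
Definition F (s : R) : R :=
  K0 / 2 * s ^+ 2 - (n%:R - 4) / (2 * n%:R) * s `^ (2 * n%:R / (n%:R - 4)).

(* F' on [0, +oo[, one-sided at 0; the exponent is 2n/(n-4) - 1. *)
Definition dF (s : R) : R :=
  K0 * s - s `^ ((n%:R + 4) / (n%:R - 4)).

End Constants.

Arguments K2 : clear implicits.
Arguments K0 : clear implicits.
Arguments Lbound : clear implicits.

Section Sobolev.
Variables (R : realType) (a b : R).
Local Notation mu := (@lebesgue_measure R).
Local Notation I := (`]a, b[%classic : set R).
Implicit Types f g phi : R -> R.

(* C_c^oo(a, b), its elements being extended by 0 to the real line. *)
Definition test_function phi : Prop :=
  (forall (k : nat) (x : R), derivable (derive1n k phi) x 1) /\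
  exists c d : R,
    [/\ a < c, d < b & forall x : R, x \notin `[c, d] -> phi x = 0].

Definition L2 f : Prop :=
  measurable_fun I f /\ mu.-integrable I (fun x => (f x ^+ 2)%:E).

Definition is_weak_deriv f g : Prop :=
  [/\ locally_integrable I f, locally_integrable I g &
      forall phi, test_function phi ->
        \int[mu]_(x in I) (f x * derive1 phi x) =
        - \int[mu]_(x in I) (g x * phi x)].

(* The weak derivative is unique up to null sets; this is a representative,
   and 0 when no weak derivative exists. *)
Definition wderiv f : R -> R := xget (fun=> 0) [set g | is_weak_deriv f g].

Definition H1 f : Prop :=
  [/\ L2 f, is_weak_deriv f (wderiv f) & L2 (wderiv f)].

Definition H2 f : Prop := H1 f /\ H1 (wderiv f).

(* H^1_0 is the closure of C_c^oo in H^1. *)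
Definition H10 f : Prop :=
  H1 f /\
  exists phi : nat -> R -> R,
    (forall k, test_function (phi k)) /\
    \int[mu]_(x in I) ((phi k x - f x) ^+ 2 +
                       (derive1 (phi k) x - wderiv f x) ^+ 2) @[k --> \oo] --> (0 : R).

(* An element of H^2(a, b) is identified with its representative that is
   continuous on [a, b]; the values outside [a, b] are irrelevant. *)
Definition Hspace f : Prop :=
  [/\ {within `[a, b], continuous f}, H2 f & H10 (wderiv f)].

Definition Hdot f g : R :=
  \int[mu]_(x in I) (wderiv (wderiv f) x * wderiv (wderiv g) x +
                     wderiv f x * wderiv g x + f x * g x).

Definition Hnorm f : R := Num.sqrt (Hdot f f).

End Sobolev.

Section MountainPass.
Variables (R : realType) (n : nat) (t1 t2 : R).
Local Notation mu := (@lebesgue_measure R).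
Local Notation I := (`]t1, t2[%classic : set R).
Local Notation H := (Hspace t1 t2).
Local Notation D := (wderiv t1 t2).
Local Notation L := (Lbound R n).
Implicit Types (v w phi : R -> R) (gamma : R -> R -> R).

Definition J v : R :=
  \int[mu]_(t in I)
    (2^-1 * D (D v) t ^+ 2 - K2 R n / 2 * D v t ^+ 2 + F n (v t)).

Definition between0L v : Prop :=
  forall t : R, t \in `[t1, t2] -> 0 <= v t <= L.

Definition critical_point v : Prop :=
  [/\ H v, between0L v &
      forall phi, H phi ->
        \int[mu]_(t in I) (D (D v) t * D (D phi) t
                           - K2 R n * D v t * D phi t
                           + dF n (v t) * phi t) = 0].

Definition Gamma gamma : Prop :=
  [/\ forall tau : R, tau \in `[0, 1] ->
        H (gamma tau) /\ between0L (gamma tau),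
      forall tau : R, tau \in `[0, 1] ->
        Hnorm t1 t2 (gamma s \- gamma tau)
          @[s --> within `[0, 1] (nbhs tau)] --> (0 : R),
      forall t : R, t \in `[t1, t2] -> gamma 0 t = 0 &
      forall t : R, t \in `[t1, t2] -> gamma 1 t = L].

Definition mp_level : \bar R :=
  ereal_inf [set ereal_sup [set (J (gamma tau))%:E | tau in `[0, 1]]
            | gamma in Gamma].

Definition mp_critical_point v : Prop :=
  [/\ critical_point v, (J v)%:E = mp_level & 0 < J v].

Definition suitably_large : Prop :=
  forall w, mp_critical_point w ->
    ~ exists c : R, forall t : R, t \in `[t1, t2] -> w t = c.

Definition periodic_reflection (v0 v : R -> R) : Prop :=
  [/\ forall t : R, t \in `[t1, t2] -> v t = v0 t,
      forall t : R, t \in `[t2, 2 * t2 - t1] -> v t = v0 (2 * t2 - t) &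
      forall t, v (t + 2 * (t2 - t1)) = v t].

End MountainPass.

Definition C4 (R : realType) (v : R -> R) : Prop :=
  (forall (k : nat) (t : R), (k < 4)%N -> derivable (derive1n k v) t 1) /\
  continuous (derive1n 4 v).

Definition mountain_pass_solution (R : realType) (n : nat) (T : R)
    (v : R -> R) : Prop :=
  exists (t1 t2 : R) (v0 : R -> R),
    [/\ t1 < t2, T = t2 - t1, suitably_large n t1 t2,
        mp_critical_point n t1 t2 v0 & periodic_reflection t1 t2 v0 v] /\
    [/\ forall t, 0 < v t, C4 v &
        forall t, derive1n 4 v t + K2 R n * derive1n 2 v t + K0 R n * v t
                  = v t `^ ((n%:R + 4) / (n%:R - 4))].

Section Euclidean.
Variables (R : realType) (n : nat).
Implicit Types (x : 'rV[R]_n) (u : 'rV[R]_n -> R).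

(* The library norm on ['rV_n] is the sup norm. *)
Definition enorm x : R := Num.sqrt (\sum_(i < n) x 0 i ^+ 2).

Definition partial (i : 'I_n) u : 'rV[R]_n -> R :=
  fun x => 'D_(delta_mx 0 i) u x.

Definition grad u x : 'rV[R]_n := \row_(i < n) partial i u x.

Definition laplacian u x : R := \sum_(i < n) partial i (partial i u) x.

(* The value at x = 0 is irrelevant. *)
Definition emden_fowler (v : R -> R) x : R :=
  enorm x `^ (- ((n%:R - 4) / 2)) * v (ln (enorm x)).

(* Scalar curvature of g = u^(4/(n-4)) g_0, i.e. w^(4/(n-2)) g_0 with
   w = u^((n-2)/(n-4)), given by the conformal transformation law
   R_g = - 4(n-1)/(n-2) w^(-(n+2)/(n-2)) Delta w. *)
Definition scalar_curvature u x : R :=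
  - (4 * (n%:R - 1) / (n%:R - 2)) * u x `^ (- ((n%:R + 2) / (n%:R - 4)))
  * laplacian (fun y => u y `^ ((n%:R - 2) / (n%:R - 4))) x.

End Euclidean.

(* Main.v *)
Require Import Defs.
From HB Require Import structures.
From mathcomp Require Import all_boot all_order all_algebra.
From mathcomp Require Import all_classical all_reals all_analysis.
From mathcomp Require Import ring lra.
Import Order.TTheory GRing.Theory Num.Theory.
Import numFieldNormedType.Exports.

(** With g = v'/v and X = v''/v, the inequality for u becomes the one-dimensional
    inequality w <= - c v^(4/(n-4)) for
    w = X + (2/(n-4)) g^2 - (n-2)(n-4)/4 and c = sqrt(n(n-4)/(n^2-4)),
    i.e. a lower bound on - w v^(-4/(n-4)), which up to a positive constant is the
    scalar curvature of u^(4/(n-4)) g_0.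
    At a minimum of the scalar curvature, the Q-curvature equation gives
    (v^(4) + K2 v'' + K0 v)/v <= c^(-2) w^2: the difference consists of a square
    (the trace-free Ricci tensor) and of a Laplacian term of the right sign.
    Hence w^2 >= c^2 v^(8/(n-4)) there, and it remains to know that w < 0.
    For this, replace v by v + s with s >= 0: the fourth order operator stays
    positive on v + s, and w < 0 for large s, so that a largest s for which
    w vanishes somewhere would contradict the same estimate. *)

Set Implicit Arguments.
Unset Strict Implicit.
Unset Printing Implicit Defensive.

Local Open Scope classical_set_scope.
Local Open Scope ring_scope.

(** * One-variable calculus: derivative rules, maxima, periodic functions *)

Section RealDerivatives.
Context {R : realType}.
Implicit Types (f g h : R -> R) (a b x y t : R).

Lemma is_derive_addr f g x a b :
  is_derive x 1 f a -> is_derive x 1 g b ->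
  is_derive x 1 (fun t => f t + g t) (a + b).
Proof. by move=> fa gb; exact: is_deriveD. Qed.

Lemma is_derive_subr f g x a b :
  is_derive x 1 f a -> is_derive x 1 g b ->
  is_derive x 1 (fun t => f t - g t) (a - b).
Proof. by move=> fa gb; exact: is_deriveB. Qed.

Lemma is_derive_mulr f g x a b :
  is_derive x 1 f a -> is_derive x 1 g b ->
  is_derive x 1 (fun t => f t * g t) (a * g x + f x * b).
Proof.
move=> fa gb; apply: is_derive_eq (is_deriveM fa gb) _.
by rewrite addrC; congr (_ + _); exact: mulrC.
Qed.

Lemma is_derive_const c x : is_derive x 1 (fun=> c : R) (0 : R).
Proof. exact: is_derive_cst. Qed.

Lemma is_derive_divr f g x a b : g x != 0 ->
  is_derive x 1 f a -> is_derive x 1 g b ->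
  is_derive x 1 (fun t => f t / g t) (a / g x - (f x / g x) * (b / g x)).
Proof.
move=> gx0 fa gb; have gV := is_deriveV gx0 gb.
apply: is_derive_eq (is_derive_mulr fa gV) _.
by rewrite /GRing.scale /=; field.
Qed.

Lemma is_derive_continuous f x a : is_derive x 1 f a -> {for x, continuous f}.
Proof. by case=> fx _; exact/differentiable_continuous/derivable1_diffP. Qed.

(** If [d] were positive, [h'] would vanish at [t0] and be positive just to its right, and the mean
    value theorem would produce a value of [h] above the maximum. *)
Lemma max_second_derivative h h' d t0 :
  (forall t : R, is_derive t 1 h (h' t)) -> is_derive t0 1 h' d ->
  (forall t, h t <= h t0) -> h' t0 = 0 /\ d <= 0.
Proof.
move=> hD h'D hmax.
have h'0 : h' t0 = 0.
  have t0in : t0 \in `]t0 - 1, t0 + 1[ by rewrite in_itv /=; lra.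
  have h0 : is_derive t0 1 h 0.
    apply: derive1_at_max t0in (fun t _ => hmax t); first lra.
    by move=> t _; case: (hD t).
  by case: (hD t0) => _ <-; case: h0.
split=> //; rewrite leNgt; apply/negP => d_gt0.
have /cvgrPdist_lt/(_ _ d_gt0) :
    s^-1 *: ((h' \o shift t0) (s *: 1) - h' t0) @[s --> 0^'] --> d.
  by case: h'D => h'D <-.
rewrite /= near_withinE => -[e /= e_gt0 he].
have h'_gt0 t : t0 < t < t0 + e -> 0 < h' t.
  move=> /andP[t0t te].
  have := he (t - t0).
  have s_gt0 : 0 < t - t0 by rewrite subr_gt0.
  have s_lt : t - t0 < e by rewrite ltrBlDl.
  rewrite /= sub0r normrN gtr0_norm // => /(_ s_lt (lt0r_neq0 s_gt0)).
  rewrite h'0 subr0 [(t - t0)%:A]mulr1 subrK => /(le_lt_trans (ler_norm _)).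
  by rewrite ltrBlDr ltrDl /GRing.scale /= pmulr_rgt0 // invr_gt0.
have t0e : t0 < t0 + e / 2 by rewrite ltrDl divr_gt0.
have hC : {within `[t0, t0 + e / 2], continuous h}.
  by apply: derivable_within_continuous => s _; case: (hD s).
have [c cin E] := MVT t0e (fun s _ => hD s) hC.
have h'c : 0 < h' c.
  by apply: h'_gt0; move: cin; rewrite in_itv /= => /andP[]; lra.
have := hmax (t0 + e / 2).
rewrite -subr_le0 E addrAC subrr add0r leNgt => /negP; apply.
by rewrite !mulr_gt0 ?invr_gt0.
Qed.

(** A maximum over the compact interval [[0, p]] is global: subtracting [floor (t / p)] periods
    brings [t] into it. *)
Lemma periodic_attains_max h p : 0 < p -> continuous h ->
  (forall t, h (t + p) = h t) -> exists t0, forall t, h t <= h t0.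
Proof.
move=> p_gt0 hc hp.
have [|c _ cmax] := @EVT_max _ h 0 p (ltW p_gt0).
  exact: continuous_subspaceT.
have hn n t : h (t + n%:R * p) = h t.
  by rewrite mulr_natl; exact: (periodicn hp).
have hz (m : int) t : h (t + m%:~R * p) = h t.
  case: m => k; first exact: hn.
  by rewrite NegzE mulrNz mulNr -[in RHS](subrK (k.+1%:R * p) t) hn.
exists c => t; rewrite -(hz (- Num.floor (t / p)) t); apply: cmax.
rewrite in_itv /= mulrNz mulNr.
have /andP[+ +] := floor_itv (t / p).
by rewrite ler_pdivlMr // ltr_pdivrMr // intrD mulrDl mul1r; lra.
Qed.

Lemma derivative_periodic f f' p : (forall t, is_derive t 1 f (f' t)) ->
  (forall t, f (t + p) = f t) -> forall t, f' (t + p) = f' t.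
Proof.
move=> fD fp t; have [_ <-] := fD (t + p); have [_ <-] := fD t.
rewrite /derive.
rewrite (_ : (fun k => k^-1 *: ((f \o shift (t + p)) (k *: 1) - f (t + p)))
    = (fun k => k^-1 *: ((f \o shift t) (k *: 1) - f t))) //.
by apply/funext => k /=; rewrite addrA !fp.
Qed.

End RealDerivatives.

(** * The fourth order operator on the cylinder and the sign of the scalar curvature *)

Section PaneitzCylinder.
Context {R : realType} (n : nat).
Hypothesis n5 : (5 <= n)%N.
Local Notation N := (n%:R : R).
Local Notation A := ((N - 2) * (N - 4) / 4).
Local Notation B := (2 / (N - 4)).
Local Notation kappa := (4 / (N - 4)).

Let N5 : 5 <= N. Proof. by rewrite ler_nat. Qed.
Let N_neq0 : N != 0. Proof. by rewrite lt0r_neq0 //; move: N5; lra. Qed.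
Let N4_neq0 : N - 4 != 0. Proof. by rewrite lt0r_neq0 //; move: N5; lra. Qed.

(* The difference of the two sides is 4(n-1)/(n(n-4)) times the square of
   X - (n-2)/(n-4) g^2 + (n-4)/2, modulo the first and second order conditions
   at the maximum. *)
Lemma paneitz_le_at_max (v v1 v2 v3 v4 : R -> R) (t0 : R) :
  (forall t, 0 < v t) ->
  (forall t : R, is_derive t 1 v (v1 t)) -> (forall t : R, is_derive t 1 v1 (v2 t)) ->
  (forall t : R, is_derive t 1 v2 (v3 t)) -> (forall t : R, is_derive t 1 v3 (v4 t)) ->
  let w t := v2 t / v t + B * (v1 t / v t) ^+ 2 - A in
  (forall t, w t * v t `^ (- kappa) <= w t0 * v t0 `^ (- kappa)) ->
  (v4 t0 + K2 R n * v2 t0 + K0 R n * v t0) / v t0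
    <= (N ^+ 2 - 4) / (N * (N - 4)) * w t0 ^+ 2.
Proof.
move=> v_gt0 D0 D1 D2 D3 w wmax.
have vN0 t : v t != 0 by rewrite gt_eqF.
(* Dividing by [v] makes the problem polynomial: [(f / v)' = f' / v - (f / v) g], with [g] the
   logarithmic derivative. *)
pose g t := v1 t / v t; pose X t := v2 t / v t.
pose Y t := v3 t / v t; pose Z t := v4 t / v t.
pose E t := v t `^ (- kappa).
have Dg (t : R) : is_derive t 1 g (X t - g t * g t) by exact: is_derive_divr.
have DX (t : R) : is_derive t 1 X (Y t - X t * g t) by exact: is_derive_divr.
have DY (t : R) : is_derive t 1 Y (Z t - Y t * g t) by exact: is_derive_divr.
have DE (t : R) : is_derive t 1 E (- kappa * g t * E t).
  have := is_derive1_comp (is_derive1_powR (- kappa) (v_gt0 t)) (D0 t).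
  move/is_derive_eq; apply.
  rewrite powRB; last by rewrite vN0 implybT.
  by rewrite powRr1 ?ltW // /g /E; field; rewrite vN0 N4_neq0.
pose g' t := X t - g t * g t; pose X' t := Y t - X t * g t.
pose w' t := X' t + B * (2 * (g t * g' t)).
(* Chosen so that [(w E)' = k E]; the positive factor [E] then drops out of the conditions at the
   maximum, which become [k t0 = 0] and [k' t0 <= 0]. *)
pose k t := w' t - kappa * (g t * w t).
have wE t : w t = X t + B * (g t * g t) - A by rewrite /w expr2.
have Dw (t : R) : is_derive t 1 w (w' t).
  rewrite (_ : w = fun t => X t + B * (g t * g t) - A); last exact/funext.
  have DB := is_derive_mulr (is_derive_const B t) (is_derive_mulr (Dg t) (Dg t)).
  have := is_derive_subr (is_derive_addr (DX t) DB) (is_derive_const A t).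
  by move/is_derive_eq; apply; rewrite /w' /g' /X'; ring.
have Dh (t : R) : is_derive t 1 (fun s => w s * E s) (k t * E t).
  have := is_derive_mulr (Dw t) (DE t).
  by move/is_derive_eq; apply; rewrite /k; ring.
pose k' t := Z t - Y t * g t - (X' t * g t + X t * g' t)
  + B * (2 * (g' t * g' t + g t * (X' t - 2 * (g t * g' t))))
  - kappa * (g' t * w t + g t * w' t).
have Dk (t : R) : is_derive t 1 k (k' t).
  have Dg' := is_derive_subr (DX t) (is_derive_mulr (Dg t) (Dg t)).
  have DX' := is_derive_subr (DY t) (is_derive_mulr (DX t) (Dg t)).
  have Dm := is_derive_mulr (is_derive_const 2 t) (is_derive_mulr (Dg t) Dg').
  have DB := is_derive_mulr (is_derive_const B t) Dm.
  have Dk2 := is_derive_mulr (is_derive_const kappa t) (is_derive_mulr (Dg t) (Dw t)).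
  have := is_derive_subr (is_derive_addr DX' DB) Dk2.
  by move/is_derive_eq; apply; rewrite /k' /X' /g'; ring.
have Dh' := is_derive_mulr (Dk t0) (DE t0).
have [] := max_second_derivative Dh Dh' wmax.
have E_gt0 : 0 < E t0 by rewrite powR_gt0.
move=> /eqP; rewrite mulf_eq0 (gt_eqF E_gt0) orbF => /eqP k0.
rewrite k0 mul0r addr0 pmulr_lle0 // => k'0.
have -> : (v4 t0 + K2 R n * v2 t0 + K0 R n * v t0) / v t0
    = Z t0 + K2 R n * X t0 + K0 R n by rewrite /Z /X; field.
rewrite -subr_ge0 (_ : _ - _ = 4 * (N - 1) / (N * (N - 4)) *
    (X t0 - (1 + B) * g t0 ^+ 2 + (N - 4) / 2) ^+ 2 - k' t0 - 2 * g t0 * k t0).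
  rewrite k0 mulr0 subr0 addr_ge0 ?oppr_ge0 // mulr_ge0 ?sqr_ge0 //.
  by rewrite divr_ge0 // ?mulr_ge0 //; move: N5; lra.
by rewrite /k' /k /w' wE /X' /g' /K2 /K0; field; rewrite N_neq0 N4_neq0.
Qed.

(** Positivity of the operator, unlike the equation, passes to [v + s]: a constant [s >= 0] adds
    [K0 s >= 0] and leaves the derivatives unchanged. *)
Lemma paneitz_gt0_scalar_curvature_gt0 (v v1 v2 v3 v4 : R -> R) (p : R) :
  0 < p -> (forall t, 0 < v t) -> (forall t, v (t + p) = v t) ->
  (forall t : R, is_derive t 1 v (v1 t)) -> (forall t : R, is_derive t 1 v1 (v2 t)) ->
  (forall t : R, is_derive t 1 v2 (v3 t)) -> (forall t : R, is_derive t 1 v3 (v4 t)) ->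
  (forall t, 0 < v4 t + K2 R n * v2 t + K0 R n * v t) ->
  forall t, v2 t / v t + B * (v1 t / v t) ^+ 2 - A < 0.
Proof.
move=> p_gt0 v_gt0 vp D0 D1 D2 D3 Pv_gt0.
have A_gt0 : 0 < A by rewrite divr_gt0 ?mulr_gt0 //; move: N5; lra.
have v1p := derivative_periodic D0 vp; have v2p := derivative_periodic D1 v1p.
(* Square root of the discriminant of the quadratic [A V^2 - v2 V - B v1^2] in [V], as
   [4 A B = 2 (N - 2)]. *)
pose D t := Num.sqrt (v2 t ^+ 2 + 2 * (N - 2) * v1 t ^+ 2).
have v1_sqr_ge0 t : 0 <= 2 * (N - 2) * v1 t ^+ 2.
  by rewrite mulr_ge0 ?sqr_ge0 //; move: N5; lra.
have D_sqr t : D t ^+ 2 = v2 t ^+ 2 + 2 * (N - 2) * v1 t ^+ 2.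
  by rewrite sqr_sqrtr // addr_ge0 ?sqr_ge0.
(* [z t] is the unique positive value of [V] at which
   [v2 t / V + B * (v1 t / V) ^+ 2 - A] vanishes, so that the extremal shift
   of [v] is the maximum of [z - v]. *)
pose z t := (v2 t + D t) / (2 * A); pose z' t := (v2 t - D t) / (2 * A).
(* The other root is nonpositive because [D >= |v2|]; hence for [V > 0] the expression has the sign
   of [z - V]. *)
have z'_le0 t : z' t <= 0.
  rewrite /z' pmulr_lle0; last by rewrite invr_gt0 mulr_gt0.
  rewrite subr_le0.
  by rewrite (le_trans (ler_norm _)) // -sqrtr_sqr ler_wsqrtr // lerDl.
have w_factor (V : R) t : V != 0 -> v2 t / V + B * (v1 t / V) ^+ 2 - A
    = - (A * (V - z t) * (V - z' t) / V ^+ 2).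
  move=> V0; rewrite /z /z'.
  rewrite [RHS](_ : _ = v2 t / V - A
      + (D t ^+ 2 - v2 t ^+ 2) / ((N - 2) * (N - 4)) / V ^+ 2).
    rewrite D_sqr; field; rewrite V0 N4_neq0 /=.
    by rewrite lt0r_neq0 //; move: N5; lra.
  field; rewrite V0 N4_neq0 /=.
  by rewrite lt0r_neq0 //; move: N5; lra.
have s_cont : continuous (fun t => z t - v t).
  move=> t; apply: continuousB; last exact: is_derive_continuous (D0 t).
  apply: continuousM; last exact: cst_continuous.
  apply: continuousD; first exact: is_derive_continuous (D2 t).
  apply: continuous_comp; last exact: sqrt_continuous.
  have sqr_cont (f : R -> R) (d : R) :
      is_derive (t : R) 1 f d -> {for t, continuous (fun s => f s ^+ 2)}.
    by move=> /is_derive_continuous fC; exact: (continuousM fC fC).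
  apply: continuousD; first exact: sqr_cont (D2 t).
  by apply: continuousM; [exact: cst_continuous|exact: sqr_cont (D1 t)].
have [t0 t0max] : exists t0, forall t, z t - v t <= z t0 - v t0.
  apply: periodic_attains_max p_gt0 s_cont _ => t.
  by rewrite /z /D v2p v1p vp.
suff s_lt0 : z t0 - v t0 < 0.
  move=> t; rewrite w_factor ?gt_eqF // oppr_lt0.
  have zv : z t < v t by rewrite -subr_lt0 (le_lt_trans (t0max t)).
  rewrite divr_gt0 ?exprn_gt0 //; apply: mulr_gt0.
    by apply: mulr_gt0; rewrite ?subr_gt0.
  by rewrite subr_gt0 (le_lt_trans (z'_le0 t)).
rewrite ltNge; apply/negP => s_ge0.
(* This shift touches [z] from above at [t0]: the expression vanishes there and is nonpositive
   everywhere, so its product with the positive power of [V] is maximal at [t0]. The estimate then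
   contradicts positivity of the operator on [V]. *)
pose V t := v t + (z t0 - v t0).
have V_gt0 t : 0 < V t by rewrite ltr_wpDr.
have DV (t : R) : is_derive t 1 V (v1 t).
  by have /is_derive_eq := is_derive_addr (D0 t) (is_derive_const (z t0 - v t0) t);
    apply; rewrite addr0.
have w0 : v2 t0 / V t0 + B * (v1 t0 / V t0) ^+ 2 - A = 0.
  have V0 : V t0 = z t0 by rewrite /V addrC subrK.
  by rewrite w_factor ?gt_eqF // V0 subrr mulr0 !mul0r oppr0.
have /= := @paneitz_le_at_max V v1 v2 v3 v4 t0 V_gt0 DV D1 D2 D3.
rewrite w0 mul0r expr0n mulr0 => PV_le0.
have {}PV_le0 : (v4 t0 + K2 R n * v2 t0 + K0 R n * V t0) / V t0 <= 0.
  apply: PV_le0 => t; rewrite w_factor ?gt_eqF // mulNr oppr_le0.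
  rewrite mulr_ge0 ?powR_ge0 // divr_ge0 ?sqr_ge0 //; apply: mulr_ge0.
    by apply: mulr_ge0; [exact: ltW|rewrite subr_ge0 -lerBlDl].
  by rewrite subr_ge0 (le_trans (z'_le0 t)) // ltW.
move: PV_le0; apply/negP; rewrite -ltNge divr_gt0 //.
rewrite /V mulrDr addrA ltr_wpDr // mulr_ge0 // /K0.
by rewrite divr_ge0 // mulr_ge0 ?sqr_ge0.
Qed.

Lemma scalar_curvature_lower_bound (v v1 v2 v3 v4 : R -> R) (p : R) :
  0 < p -> (forall t, 0 < v t) -> (forall t, v (t + p) = v t) ->
  (forall t : R, is_derive t 1 v (v1 t)) -> (forall t : R, is_derive t 1 v1 (v2 t)) ->
  (forall t : R, is_derive t 1 v2 (v3 t)) -> (forall t : R, is_derive t 1 v3 (v4 t)) ->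
  (forall t, v4 t + K2 R n * v2 t + K0 R n * v t = v t `^ ((N + 4) / (N - 4))) ->
  forall t, Num.sqrt (N * (N - 4) / (N ^+ 2 - 4)) * v t `^ kappa
    <= A - v2 t / v t - B * (v1 t / v t) ^+ 2.
Proof.
move=> p_gt0 v_gt0 vp D0 D1 D2 D3 Pv.
pose w t := v2 t / v t + B * (v1 t / v t) ^+ 2 - A.
pose c := Num.sqrt (N * (N - 4) / (N ^+ 2 - 4)).
have vk_gt0 t : 0 < v t `^ kappa by rewrite powR_gt0.
have Pv_gt0 t : 0 < v4 t + K2 R n * v2 t + K0 R n * v t by rewrite Pv powR_gt0.
have w_lt0 t : w t < 0.
  exact: paneitz_gt0_scalar_curvature_gt0 p_gt0 v_gt0 vp D0 D1 D2 D3 Pv_gt0 t.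
have v1p := derivative_periodic D0 vp; have v2p := derivative_periodic D1 v1p.
have h_cont : continuous (fun t => w t * v t `^ (- kappa)).
  move=> t; have quot_cont (f : R -> R) (d : R) (fd : is_derive (t : R) 1 f d) :
      {for t, continuous (fun s => f s / v s)}.
    apply: continuousM; first exact: is_derive_continuous fd.
    by apply: continuousV; rewrite ?gt_eqF //; exact: is_derive_continuous (D0 t).
  apply: continuousM; last first.
    have vkD := is_derive1_powR (- kappa) (v_gt0 t).
    exact: is_derive_continuous (is_derive1_comp vkD (D0 t)).
  apply: continuousB; last exact: cst_continuous.
  apply: continuousD; first exact: quot_cont (D2 t).
  apply: continuousM; first exact: cst_continuous.
  have v1C := quot_cont _ _ (D1 t); exact: (continuousM v1C v1C).
have [t0 t0max] : exists t0, forall t,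
    w t * v t `^ (- kappa) <= w t0 * v t0 `^ (- kappa).
  apply: periodic_attains_max p_gt0 h_cont _ => t.
  by rewrite /w v2p v1p vp.
have h0 : w t0 * v t0 `^ (- kappa) <= - c.
  rewrite powRN ler_pdivrMr // mulNr lerNr.
  (* Both sides may be squared because [w < 0]. Dividing the equation by [v] leaves the power
     [8 / (n - 4)], twice kappa, so the estimate at the maximum is the squared inequality. *)
  rewrite -(@ler_pXn2r _ 2) ?nnegrE ?mulr_ge0 ?sqrtr_ge0 ?powR_ge0 //; last first.
    by rewrite oppr_ge0 ltW.
  have := paneitz_le_at_max v_gt0 D0 D1 D2 D3 t0max.
  rewrite Pv -/(w t0) -{2}(powRr1 (ltW (v_gt0 t0))) -powRB; last first.
    by rewrite (gt_eqF (v_gt0 t0)) implybT.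
  rewrite (_ : _ / _ - 1 = kappa + kappa); last by field.
  rewrite powRD ?(gt_eqF (v_gt0 t0)) ?implybT // -expr2 sqrrN => vw.
  have c2_ge0 : 0 <= N * (N - 4) / (N ^+ 2 - 4).
    rewrite divr_ge0 ?mulr_ge0 //; move: N5; nra.
  rewrite exprMn sqr_sqrtr.
    rewrite (le_trans (ler_wpM2l c2_ge0 vw)) // mulrA.
    rewrite [X in X * w t0 ^+ 2](_ : _ = 1) ?mul1r //; field.
    by rewrite N_neq0 N4_neq0 /= lt0r_neq0 //; move: N5; nra.
  exact: c2_ge0.
move=> t; have := le_trans (t0max t) h0.
by rewrite powRN ler_pdivrMr // mulNr lerNr /w /c; lra.
Qed.

End PaneitzCylinder.

(** * Radial functions on punctured space, in the logarithmic radius *)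

Section Radial.
Context {R : realType} {n : nat}.
Implicit Types (x y : 'rV[R]_n) (u : 'rV[R]_n -> R) (i : 'I_n).

(** A polynomial in the coordinates, easier to differentiate than the norm; [ln (sqnorm x) / 2] is
    the logarithm of the Euclidean radius, the cylinder variable [t]. *)
Definition sqnorm x : R := \sum_(i < n) x 0 i ^+ 2.

Lemma sqnorm_gt0 x : x != 0 -> 0 < sqnorm x.
Proof.
rewrite lt_def sumr_ge0 ?andbT => [|i _]; last exact: sqr_ge0.
apply: contra => /eqP/psumr_eq0P x0; apply/eqP/rowP => i.
by have /eqP := x0 (fun j _ => sqr_ge0 (x 0 j)) i isT; rewrite sqrf_eq0 mxE => /eqP.
Qed.

Lemma sqnorm_shift x i h :
  sqnorm (h *: delta_mx 0 i + x) = sqnorm x + 2 * h * x 0 i + h ^+ 2.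
Proof.
rewrite /sqnorm (bigD1 i) //= [in RHS](bigD1 i) //= !mxE !eqxx mulr1.
rewrite (eq_bigr (fun j => x 0 j ^+ 2)) => [|j jNi]; first by ring.
by rewrite !mxE eqxx (negbTE jNi) mulr0 add0r.
Qed.

(** Both difference quotients coincide; partial derivatives thus reduce to the one-variable
    rules. *)
Lemma is_derive_line u x y d :
  is_derive (0 : R) 1 (fun h : R => u (h *: y + x)) d -> is_derive x y u d.
Proof.
move=> [ud <-]; split; first exact/derivable1P.
rewrite /derive.
rewrite (_ : (fun h : R => h^-1 *: (((fun h0 : R => u (h0 *: y + x)) \o shift 0) (h *: 1)
    - u (0 *: y + x))) = (fun h => h^-1 *: ((u \o shift x) (h *: y) - u x))) //.
by apply/funext => h /=; rewrite addr0 scale0r add0r [h%:A]mulr1.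
Qed.

(** Radial formulas hold off the origin; holding near [x], they may be differentiated there. *)
Lemma near_neq0 x : x != 0 -> \forall y \near x, y != 0.
Proof.
move=> x0; have : nbhs x (~` [set 0]).
  apply: open_nbhs_nbhs; split; last exact/eqP.
  exact/closed_openC/accessible_closed_set1/hausdorff_accessible/norm_hausdorff.
by apply: filterS => y /eqP.
Qed.

Lemma is_derive_sqnorm_line x i :
  is_derive (0 : R) 1 (fun h => sqnorm (h *: delta_mx 0 i + x)) (2 * x 0 i).
Proof.
rewrite (_ : (fun h => _) = fun h : R => sqnorm x + h * (2 * x 0 i) + h * h); last first.
  by apply/funext => h; rewrite sqnorm_shift; ring.
have Did := @is_derive_id R R (0 : R) 1.
have Dx := is_derive_mulr Did (is_derive_const (2 * x 0 i) 0).
have D := is_derive_addr (is_derive_const (sqnorm x) 0) Dx.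
by have /is_derive_eq := is_derive_addr D (is_derive_mulr Did Did); apply; ring.
Qed.

Lemma is_derive_log_radius (V V' : R -> R) x i : x != 0 ->
  (forall t : R, is_derive t 1 V (V' t)) ->
  is_derive (0 : R) 1
    (fun h => V (ln (sqnorm (h *: delta_mx 0 i + x)) / 2))
    (V' (ln (sqnorm x) / 2) * (x 0 i / sqnorm x)).
Proof.
move=> x0 DV; have S_gt0 := sqnorm_gt0 x0.
have DS := is_derive_sqnorm_line x i.
have S0 : sqnorm ((0 : R) *: delta_mx 0 i + x) = sqnorm x by rewrite scale0r add0r.
have Dln : is_derive (sqnorm ((0 : R) *: delta_mx 0 i + x)) 1 (@ln R) (sqnorm x)^-1.
  by rewrite S0; exact: is_derive1_ln.
have D := is_derive_mulr (is_derive1_comp Dln DS) (is_derive_const 2^-1 0).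
have := is_derive1_comp (DV _) D.
by move/is_derive_eq; apply; rewrite /= S0; field; rewrite gt_eqF.
Qed.

Variables (u : 'rV[R]_n -> R) (V V1 V2 : R -> R).
Hypothesis uV : forall x, x != 0 -> u x = V (ln (sqnorm x) / 2).
Hypothesis DV : forall t : R, is_derive t 1 V (V1 t).
Hypothesis DV1 : forall t : R, is_derive t 1 V1 (V2 t).

Lemma partial_radial x i : x != 0 ->
  partial i u x = V1 (ln (sqnorm x) / 2) * (x 0 i / sqnorm x).
Proof.
move=> x0; rewrite /partial (@near_eq_derive _ _ _ _ (fun y => V (ln (sqnorm y) / 2))).
  apply: derive_val; apply: is_derive_line.
  exact: is_derive_log_radius i x0 DV.
by near=> y; apply: uV; near: y; exact: near_neq0.
Unshelve. all: by end_near. Qed.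

Lemma sqnorm_grad_radial x : x != 0 ->
  enorm (grad u x) ^+ 2 = V1 (ln (sqnorm x) / 2) ^+ 2 / sqnorm x.
Proof.
move=> x0; have S_gt0 := sqnorm_gt0 x0.
rewrite /enorm sqr_sqrtr; last by apply: sumr_ge0 => i _; exact: sqr_ge0.
under eq_bigr => i _ do rewrite mxE partial_radial // exprMn exprMn.
rewrite -mulr_sumr -mulr_suml -/(sqnorm x).
by field; rewrite gt_eqF.
Qed.

(** Summing the second partials, the terms in [x 0 i ^+ 2] add up to [V2 - 2 V1] and the others to
    [n V1], each over [sqnorm x]. Serves both for [u] and for its power in the scalar curvature. *)
Lemma laplacian_radial x : x != 0 ->
  laplacian u x = (V2 (ln (sqnorm x) / 2) + (n%:R - 2) * V1 (ln (sqnorm x) / 2))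
                  / sqnorm x.
Proof.
move=> x0; have S_gt0 := sqnorm_gt0 x0; have S_neq0 := lt0r_neq0 S_gt0.
set t := ln _ / 2.
have partial2 i : partial i (partial i u) x
    = (V2 t - 2 * V1 t) / sqnorm x ^+ 2 * x 0 i ^+ 2 + V1 t / sqnorm x.
  rewrite [LHS](@near_eq_derive _ _ _ _
    (fun y => V1 (ln (sqnorm y) / 2) * (y 0 i / sqnorm y))); last first.
    by near=> y; apply: partial_radial; near: y; exact: near_neq0.
  have DS := is_derive_sqnorm_line x i.
  have Dx : is_derive (0 : R) 1 (fun h : R => (h *: delta_mx 0 i + x) 0 i) 1.
    have Did := @is_derive_id R R (0 : R) 1.
    rewrite (_ : (fun h => _) = fun h : R => h + x 0 i); last first.
      by apply/funext => h; rewrite !mxE !eqxx mulr1.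
    have /is_derive_eq := is_derive_addr Did (is_derive_const (x 0 i) 0).
    by apply; rewrite addr0.
  have S0 : sqnorm ((0 : R) *: delta_mx 0 i + x) != 0 by rewrite scale0r add0r.
  have := is_derive_mulr (is_derive_log_radius i x0 DV1) (is_derive_divr S0 Dx DS).
  rewrite scale0r add0r -/t => D.
  have {D} [_ ->] : is_derive x (delta_mx 0 i)
    (fun y => V1 (ln (sqnorm y) / 2) * (y 0 i / sqnorm y)) _ := is_derive_line D.
  by field.
rewrite /laplacian; under eq_bigr => i _ do rewrite partial2.
rewrite big_split /= -mulr_sumr -/(sqnorm x) sumr_const card_ord -mulr_natl.
by field.
Unshelve. all: by end_near. Qed.

End Radial.

(** * Transfer from the cylinder to punctured space *)

Lemma emden_fowlerE {R : realType} {n : nat} (v : R -> R) (x : 'rV[R]_n) : x != 0 ->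
  emden_fowler v x = expR (- ((n%:R - 4) / 2) * (ln (sqnorm x) / 2))
                     * v (ln (sqnorm x) / 2).
Proof.
move=> /sqnorm_gt0 S_gt0; rewrite /emden_fowler.
have r_gt0 : 0 < enorm x by rewrite sqrtr_gt0.
have -> : ln (enorm x) = ln (sqnorm x) / 2.
  by rewrite /enorm -/(sqnorm x) -powR12_sqrt ?ltW // ln_powR mulrC.
rewrite /powR gt_eqF //; congr (expR (_ * _) * _).
by rewrite /enorm -/(sqnorm x) -powR12_sqrt ?ltW // ln_powR mulrC.
Qed.

Lemma is_derive_expR_mul {R : realType} (a : R) (f f' : R -> R) :
  (forall t : R, is_derive t 1 f (f' t)) ->
  forall t : R, is_derive t 1 (fun s => expR (a * s) * f s)
    (expR (a * t) * (a * f t + f' t)).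
Proof.
move=> Df t.
have Dat := is_derive_mulr (is_derive_const a t) (@is_derive_id R R t 1).
have := is_derive_mulr (is_derive1_comp (is_derive_expR _) Dat) (Df t).
by move/is_derive_eq; apply; rewrite /=; ring.
Qed.

Unset Implicit Arguments.
Set Strict Implicit.
Set Printing Implicit Defensive.

Theorem theorem1p4 (R : realType) (n : nat) (T : R) (v : R -> R)
    (u : 'rV[R]_n -> R)
    (n5 : (5 <= n)%N)
    (hv : mountain_pass_solution n T v)
    (hu : forall x : 'rV[R]_n, x != 0 -> u x = emden_fowler v x) :
  (forall x : 'rV[R]_n, x != 0 ->
     Num.sqrt (n%:R * (n%:R - 4) / (n%:R ^+ 2 - 4))
       * u x `^ (n%:R / (n%:R - 4))
     + 2 / (n%:R - 4) * (enorm (grad u x) ^+ 2 / u x)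
     <= - laplacian u x) /\
  (forall x : 'rV[R]_n, x != 0 -> 0 < scalar_curvature u x).
Proof.
have [t1 [t2 [v0 [[t12 _ _ _ [_ _ vp]] [v_gt0 [vD _] Pv]]]]] := hv.
have N5 : 5 <= n%:R :> R by rewrite ler_nat.
have N_gt0 : 0 < n%:R - 4 :> R by lra.
have N4_neq0 := lt0r_neq0 N_gt0.
pose vk k := derive1n k v.
have Dv k (t : R) : (k < 4)%N -> is_derive t 1 (vk k) (vk k.+1 t).
  by move=> k4; rewrite /vk derive1nS derive1E; exact/derivableP/vD.
have p_gt0 : 0 < 2 * (t2 - t1) by rewrite mulr_gt0 ?subr_gt0.
have v_ineq := scalar_curvature_lower_bound n5 p_gt0 v_gt0 vp
  (fun t => Dv 0 t isT) (fun t => Dv 1 t isT) (fun t => Dv 2 t isT)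
  (fun t => Dv 3 t isT) Pv.
(* [V] is [u] as a function of [t = ln |x|], with first two derivatives [V1] and [V2]. *)
pose m : R := (n%:R - 4) / 2; pose e t := expR (- m * t).
pose V t := e t * v t; pose V1 t := e t * (- m * v t + vk 1 t).
pose V2 t := e t * (- m * (- m * v t + vk 1 t) + (- m * vk 1 t + vk 2 t)).
have e_gt0 t : 0 < e t by exact: expR_gt0.
have V_gt0 t : 0 < V t by exact: mulr_gt0.
have DV (t : R) : is_derive t 1 V (V1 t).
  exact: (is_derive_expR_mul (- m) (fun t => Dv 0 t isT)).
have DV1 (t : R) : is_derive t 1 V1 (V2 t).
  apply: (@is_derive_expR_mul R (- m) (fun s => - m * v s + vk 1 s)
    (fun s => - m * vk 1 s + vk 2 s)) => s.
  have Dm := is_derive_mulr (is_derive_const (- m) s) (Dv 0 s isT).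
  by have /is_derive_eq := is_derive_addr Dm (Dv 1 s isT); apply; rewrite mul0r add0r.
have uV (x : 'rV[R]_n) : x != 0 -> u x = V (ln (sqnorm x) / 2).
  by move=> x0; rewrite hu // emden_fowlerE.
have ineq (x : 'rV[R]_n) : x != 0 ->
     Num.sqrt (n%:R * (n%:R - 4) / (n%:R ^+ 2 - 4))
       * u x `^ (n%:R / (n%:R - 4))
     + 2 / (n%:R - 4) * (enorm (grad u x) ^+ 2 / u x)
     <= - laplacian u x.
  move=> x0; have S_gt0 := sqnorm_gt0 x0.
  rewrite (laplacian_radial uV DV DV1 x0) (sqnorm_grad_radial uV DV x0) uV //.
  set t := ln (sqnorm x) / 2.
  have S_exp : sqnorm x = expR (2 * t) by rewrite mulrC divfK // lnK.
  (* Since [4 m / (n - 4) = 2], this power is [exp (- 2 t)]. *)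
  have eS : e t `^ (4 / (n%:R - 4)) = (sqnorm x)^-1.
    rewrite /e -expRM S_exp -expRN; congr expR; rewrite /m; field.
    exact: N4_neq0.
  have -> : V t `^ (n%:R / (n%:R - 4))
      = V t / sqnorm x * v t `^ (4 / (n%:R - 4)).
    rewrite (_ : n%:R / _ = 1 + 4 / (n%:R - 4)); last by field.
    rewrite powRD ?(gt_eqF (V_gt0 t)) ?implybT // powRr1 ?ltW //.
    by rewrite powRM ?ltW // eS; ring.
  have VS : 0 <= V t / sqnorm x by rewrite divr_ge0 ?ltW.
  (* Multiplied by [V / |x|^2], the cylinder inequality becomes the one for [u]: as
     [2 m / (n - 4) = 1], the terms linear in [v' / v] coming from the Laplacian and the gradient
     cancel, and the constants combine to [(n - 2) (n - 4) / 4]. *)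
  have := ler_wpM2l VS (v_ineq t).
  rewrite -lerBrDr mulrCA; congr (_ <= _).
  rewrite /V /V1 /V2 -/(vk 1) -/(vk 2) /m; field.
  by rewrite N4_neq0 !lt0r_neq0.
split=> // x x0; have S_gt0 := sqnorm_gt0 x0.
(* Here [a - 1 = 2 / (n - 4)] is the gradient coefficient of the inequality, so the Laplacian of
   [u^a], which is [a u^(a - 1)] times [Delta u + (a - 1) |grad u|^2 / u], is negative. *)
set a : R := (n%:R - 2) / (n%:R - 4).
have a_gt0 : 0 < a by rewrite divr_gt0 //; lra.
pose W1 t := a * V t `^ (a - 1) * V1 t.
pose W2 t := a * V t `^ (a - 1) * (V2 t + (a - 1) * (V1 t ^+ 2 / V t)).
have DVa (b : R) (t : R) :
    is_derive t 1 (fun s => V s `^ b) (b * V t `^ (b - 1) * V1 t).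
  exact: is_derive1_comp (is_derive1_powR b (V_gt0 t)) (DV t).
have DW (t : R) : is_derive t 1 (fun s => V s `^ a) (W1 t) by exact: DVa.
have DW1 (t : R) : is_derive t 1 W1 (W2 t).
  have D := is_derive_mulr (is_derive_const a t) (DVa (a - 1) t).
  have /is_derive_eq := is_derive_mulr D (DV1 t); apply.
  rewrite [_ `^ (a - 1 - 1)]powRB; last by rewrite (gt_eqF (V_gt0 t)) implybT.
  rewrite powRr1 ?ltW // /W2; field; exact: lt0r_neq0.
have uW (y : 'rV[R]_n) : y != 0 -> u y `^ a = V (ln (sqnorm y) / 2) `^ a.
  by move=> y0; rewrite uV.
rewrite /scalar_curvature (laplacian_radial uW DW DW1 x0).
have := ineq x x0.
rewrite (laplacian_radial uV DV DV1 x0) (sqnorm_grad_radial uV DV x0) uV //.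
set t := ln (sqnorm x) / 2 => ineq_x.
have V_lt0 : (V2 t + (n%:R - 2) * V1 t + (a - 1) * (V1 t ^+ 2 / V t)) / sqnorm x < 0.
  have cu_gt0 : 0 < Num.sqrt (n%:R * (n%:R - 4) / (n%:R ^+ 2 - 4))
      * V t `^ (n%:R / (n%:R - 4)).
    rewrite mulr_gt0 ?powR_gt0 // sqrtr_gt0 divr_gt0 ?mulr_gt0 //; nra.
  rewrite -oppr_gt0 (lt_le_trans cu_gt0) //.
  move: ineq_x; rewrite -lerBrDr => /le_trans; apply.
  rewrite le_eqVlt; apply/orP; left; apply/eqP.
  by rewrite /a; field; rewrite N4_neq0 !lt0r_neq0.
rewrite /W1 /W2.
rewrite (_ : _ / sqnorm x = a * V t `^ (a - 1)
  * ((V2 t + (n%:R - 2) * V1 t + (a - 1) * (V1 t ^+ 2 / V t)) / sqnorm x)); last first.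
  by field; rewrite !lt0r_neq0.
rewrite nmulr_rgt0; first by rewrite pmulr_rlt0 // mulr_gt0 ?powR_gt0.
rewrite nmulr_rlt0 ?powR_gt0 // oppr_lt0 divr_gt0 ?mulr_gt0 //; lra.
Qed.
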